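(* Let $(G,\mu,\sigma)$ be a finite weighted graph with vertex measure $\mu$ and signature $\sigma:E^{or}\to H$, where $H=O(d)$ or $U(d)$. Assume that $(G,\mu,\sigma)$ satisfies $CD^\sigma(K,n)$ for some $K\in\mathbb{R}$ and some $n>0$ ($n=\infty$ allowed). Then for any nonzero eigenvalue $\lambda^\sigma$ of $\Delta^\sigma$, $$\frac{n-1}{n}\lambda^\sigma\ge K,$$ where $(n-1)/n=1$ in the case $n=\infty$.
   Context: $G=(V,E,w)$ is a finite undirected simple graph with edge weights $w_{xy}=w_{yx}>0$ for $\{x,y\}\in E$; $x\sim y$ means $\{x,y\}\in E$; $\mu:V\to(0,\infty)$; $E^{or}=\{(x,y),(y,x)\mid\{x,y\}\in E\}$. $\mathbb{K}=\mathbb{R}$ if $H=O(d)$, $\mathbb{K}=\mathbb{C}$ if $H=U(d)$. A signature is a map $\sigma:E^{or}\to H$ with $\sigma_{yx}=\sigma_{xy}^{-1}$. For $u:V\to\mathbb{K}$, $\Delta u(x)=\frac1{\mu(x)}\sum_{y\sim x}w_{xy}(u(y)-u(x))$; for $f:V\to\mathbb{K}^d$, $\Delta^\sigma f(x)=\frac1{\mu(x)}\sum_{y\sim x}w_{xy}(\sigma_{xy}f(y)-f(x))$. $\lambda\in\mathbb{R}$ is called an eigenvalue of $\Delta^\sigma$ if $\Delta^\sigma f=-\lambda f$ for some nonzero $f:V\to\mathbb{K}^d$. Define $2\Gamma^\sigma(f,g)=\Delta(f^T\overline g)-f^T(\overline{\Delta^\sigma g})-(\Delta^\sigma f)^T\overline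 g$ and $2\Gamma_2^\sigma(f,g)=\Delta\Gamma^\sigma(f,g)-\Gamma^\sigma(f,\Delta^\sigma g)-\Gamma^\sigma(\Delta^\sigma f,g)$. $CD^\sigma(K,n)$ means $\Gamma_2^\sigma(f,f)(x)\ge\frac1n|\Delta^\sigma f(x)|^2+K\,\Gamma^\sigma(f,f)(x)$ for all $f:V\to\mathbb{K}^d$, $x\in V$ (with $\frac1n=0$ if $n=\infty$). *)

(* Defs.v *)
From HB Require Import structures.
From mathcomp Require Import all_boot all_order all_algebra.
From mathcomp Require Import complex.
From mathcomp Require Import reals constructive_ereal.

Set Implicit Arguments.
Unset Strict Implicit.
Unset Printing Implicit Defensive.

Import Order.TTheory GRing.Theory Num.Theory.
Local Open Scope ring_scope.

Variant structure_group := Orthogonal | Unitary.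

Section Scalars.
Variable R : realType.

(* K = R for O(d) and K = C for U(d).  The order of R[i] as a numFieldType is
   partial: z <= z' iff 'Im z = 'Im z' and 'Re z <= 'Re z'. *)
Definition scalar_field (H : structure_group) : numFieldType :=
  match H with Orthogonal => R | Unitary => R[i] end.

Definition of_real (H : structure_group) : R -> scalar_field H :=
  match H return R -> scalar_field H with
  | Orthogonal => fun a => a
  | Unitary => fun a => real_complex R a
  end.

Definition scalar_conj (H : structure_group) : scalar_field H -> scalar_field H :=
  match H return scalar_field H -> scalar_field H with
  | Orthogonal => fun z => z
  | Unitary => fun z : R[i] => Num.conj z
  end.

Definition in_group (H : structure_group) (d : nat) :
    {pred 'M[scalar_field H]_d} :=
  match H return {pred 'M[scalar_field H]_d} with
  | Orthogonal => [pred A : 'M[R]_d | A *m A^T == 1%:M]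
  | Unitary => [pred A : 'M[R[i]]_d | A \is unitarymx]
  end.

(* The dimension n ranges over ]0, +oo]; the value at -oo is irrelevant. *)
Definition inv_dim (n : \bar R) : R :=
  match n with r%:E => r^-1 | _ => 0 end.

Definition dim_ratio (n : \bar R) : R :=
  match n with r%:E => (r - 1) / r | _ => 1 end.

End Scalars.

Section WeightedGraph.
Variables (R : realType) (V : finType).

(* Only the values of the weight w and of the signature sigma on (oriented)
   edges are constrained or used. *)
Definition weighted_graph (e : rel V) (w : V -> V -> R) : Prop :=
  [/\ symmetric e, irreflexive e
    & forall x y, e x y -> w x y = w y x /\ 0 < w x y].

Definition signature (e : rel V) (H : structure_group) (d : nat)
    (sigma : V -> V -> 'M[scalar_field R H]_d) : Prop :=
  forall x y, e x y ->
    sigma x y \in @in_group R H d /\ sigma y x = invmx (sigma x y).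

Section Operators.
Variables (e : rel V) (w : V -> V -> R) (mu : V -> R).
Variables (H : structure_group) (d : nat) (sigma : V -> V -> 'M[scalar_field R H]_d).

Definition laplacian (u : V -> scalar_field R H) (x : V) : scalar_field R H :=
  of_real H (mu x)^-1 *
    \sum_(y | e x y) of_real H (w x y) * (u y - u x).

Definition connection_laplacian (f : V -> 'cV[scalar_field R H]_d) (x : V) :
    'cV[scalar_field R H]_d :=
  of_real H (mu x)^-1 *:
    \sum_(y | e x y) of_real H (w x y) *: (sigma x y *m f y - f x).

Definition hdot (a b : 'cV[scalar_field R H]_d) : scalar_field R H :=
  (a^T *m map_mx (@scalar_conj R H) b) 0 0.

Definition Gamma (f g : V -> 'cV[scalar_field R H]_d) (x : V) : scalar_field R H :=
  2^-1 * (laplacian (fun z => hdot (f z) (g z)) x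
          - hdot (f x) (connection_laplacian g x)
          - hdot (connection_laplacian f x) (g x)).

Definition Gamma2 (f g : V -> 'cV[scalar_field R H]_d) (x : V) : scalar_field R H :=
  2^-1 * (laplacian (Gamma f g) x
          - Gamma f (connection_laplacian g) x
          - Gamma (connection_laplacian f) g x).

(* Gamma f f x, Gamma2 f f x and hdot a a are always real, so for K = C the
   comparison below in the order of R[i] is the comparison of real numbers. *)
Definition CD (K : R) (n : \bar R) : Prop :=
  forall (f : V -> 'cV[scalar_field R H]_d) (x : V),
    of_real H (inv_dim n)
      * hdot (connection_laplacian f x) (connection_laplacian f x)
    + of_real H K * Gamma f f x <= Gamma2 f f x.

Definition eigenvalue_of_connection_laplacian (lambda : R) : Prop :=
  exists f : V -> 'cV[scalar_field R H]_d,
    (exists x, f x != 0) /\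
    forall x, connection_laplacian f x = - (of_real H lambda *: f x).

End Operators.
End WeightedGraph.

(* Main.v *)
Require Import Defs.
From HB Require Import structures.
From mathcomp Require Import all_boot all_order all_algebra.
From mathcomp Require Import complex.
From mathcomp Require Import boolp reals constructive_ereal.
From mathcomp Require Import ring.

Set Implicit Arguments.
Unset Strict Implicit.
Unset Printing Implicit Defensive.

Import Order.TTheory GRing.Theory Num.Theory.
Local Open Scope ring_scope.

(** The bound comes from integrating the curvature-dimension inequality of an
    eigenfunction f against mu.  The Laplacian of any function has mu-integral
    zero, because its mu-weighted values are sums over oriented edges of terms
    that change sign when the edge is reversed ([sum_laplacian]).  When
    Delta^sigma f = - lambda f with lambda real, the definitions of Gamma and
    Gamma_2 therefore lose their first term after integration, and what is left
    is, with N the integral of |f|^2,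
      the integral of Gamma(f,f)   = lambda N    ([sum_Gamma_eigenfunction]),
      the integral of Gamma_2(f,f) = lambda^2 N  ([sum_Gamma2_eigenfunction]).
    Integrating CD(K,n) thus gives lambda^2 N >= lambda^2 N / n + K lambda N.
    Since N > 0, the claim follows on dividing by lambda, provided that
    lambda > 0.  Here the signature matters: the matrices sigma_xy are
    isometries, so Gamma(f,f)(x) is a positive combination of the squared norms
    |sigma_xy f(y) - f(x)|^2 ([Gamma_ge0]); its integral lambda N is then
    nonnegative, and lambda is nonzero.

    The real and complex cases are treated together.  The two groups are
    distinguished only in the lemmas on the scalars and in the isometry
    property; everything else uses that [of_real] and [scalar_conj] are ring
    morphisms, that [of_real] preserves the order and is fixed by conjugation,
    and that z times its conjugate is nonnegative. *)

(** * Scalars *)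

Lemma of_real_is_zmod_morphism (R : realType) (H : structure_group) :
  zmod_morphism (of_real (R:=R) H).
Proof. case: H => //= a b; exact: rmorphB. Qed.

Lemma of_real_is_monoid_morphism (R : realType) (H : structure_group) :
  monoid_morphism (of_real (R:=R) H).
Proof. case: H => //=; split=> [|a b] /=; [exact: rmorph1|exact: rmorphM]. Qed.

HB.instance Definition _ (R : realType) (H : structure_group) :=
  GRing.isZmodMorphism.Build R (scalar_field R H) (of_real H)
    (@of_real_is_zmod_morphism R H).
HB.instance Definition _ (R : realType) (H : structure_group) :=
  GRing.isMonoidMorphism.Build R (scalar_field R H) (of_real H)
    (@of_real_is_monoid_morphism R H).

Lemma scalar_conj_is_zmod_morphism (R : realType) (H : structure_group) :
  zmod_morphism (@scalar_conj R H).
Proof. case: H => //= a b; exact: rmorphB. Qed.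

Lemma scalar_conj_is_monoid_morphism (R : realType) (H : structure_group) :
  monoid_morphism (@scalar_conj R H).
Proof. case: H => //=; split=> [|a b] /=; [exact: rmorph1|exact: rmorphM]. Qed.

HB.instance Definition _ (R : realType) (H : structure_group) :=
  GRing.isZmodMorphism.Build (scalar_field R H) (scalar_field R H)
    (@scalar_conj R H) (@scalar_conj_is_zmod_morphism R H).
HB.instance Definition _ (R : realType) (H : structure_group) :=
  GRing.isMonoidMorphism.Build (scalar_field R H) (scalar_field R H)
    (@scalar_conj R H) (@scalar_conj_is_monoid_morphism R H).

Lemma ler_of_real (R : realType) (H : structure_group) :
  {mono of_real (R:=R) H : a b / a <= b}.
Proof. by case: H => //= a b; rewrite lecR. Qed.

Lemma of_real_ge0 (R : realType) (H : structure_group) (a : R) :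
  (0 <= of_real H a) = (0 <= a).
Proof. by rewrite -(rmorph0 (of_real H)) ler_of_real. Qed.

Lemma of_real_gt0 (R : realType) (H : structure_group) (a : R) :
  (0 < of_real H a) = (0 < a).
Proof. by rewrite !lt0r of_real_ge0 fmorph_eq0. Qed.

Lemma scalar_conj_of_real (R : realType) (H : structure_group) (a : R) :
  scalar_conj (of_real H a) = of_real H a.
Proof.
case: H => //=; apply: conj_Creal.
by rewrite realE (lecR 0) (lecR _ 0) le_total.
Qed.

Lemma mul_scalar_conj_ge0 (R : realType) (H : structure_group)
  (z : scalar_field R H) : 0 <= z * scalar_conj z.
Proof. by case: H z => z /=; [exact: sqr_ge0 | exact: mul_conjC_ge0]. Qed.

Lemma mul_scalar_conj_eq0 (R : realType) (H : structure_group)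
  (z : scalar_field R H) : (z * scalar_conj z == 0) = (z == 0).
Proof. by rewrite mulf_eq0 fmorph_eq0 orbb. Qed.

(** * The Hermitian form and the structure group *)

Section HermitianForm.
Variables (R : realType) (H : structure_group) (d : nat).
Implicit Types (a b c : 'cV[scalar_field R H]_d).

Lemma hdotE a b : hdot a b = \sum_i a i 0 * scalar_conj (b i 0).
Proof. by rewrite /hdot !mxE; apply: eq_bigr => i _; rewrite !mxE. Qed.

Lemma hdotBl a b c : hdot (a - b) c = hdot a c - hdot b c.
Proof. by rewrite /hdot linearB mulmxBl !mxE. Qed.

Lemma hdotBr a b c : hdot c (a - b) = hdot c a - hdot c b.
Proof. by rewrite /hdot map_mxB mulmxBr !mxE. Qed.

Lemma hdotZl (r : R) a b : hdot (of_real H r *: a) b = of_real H r * hdot a b.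
Proof. by rewrite /hdot linearZ -scalemxAl !mxE. Qed.

Lemma hdotZr (r : R) a b : hdot a (of_real H r *: b) = of_real H r * hdot a b.
Proof. by rewrite /hdot map_mxZ -scalemxAr !mxE /= scalar_conj_of_real. Qed.

Lemma hdot_suml (I : finType) (P : pred I) (F : I -> 'cV[scalar_field R H]_d) b :
  hdot (\sum_(i | P i) F i) b = \sum_(i | P i) hdot (F i) b.
Proof. by rewrite /hdot linear_sum mulmx_suml summxE. Qed.

Lemma hdot_sumr (I : finType) (P : pred I) (F : I -> 'cV[scalar_field R H]_d) b :
  hdot b (\sum_(i | P i) F i) = \sum_(i | P i) hdot b (F i).
Proof.
by rewrite /hdot (raddf_sum (map_mx (scalar_conj (H:=H)))) mulmx_sumr summxE.
Qed.

Lemma hdot_ge0 a : 0 <= hdot a a.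
Proof. by rewrite hdotE sumr_ge0 // => i _; apply: mul_scalar_conj_ge0. Qed.

Lemma hdot_eq0 a : (hdot a a == 0) = (a == 0).
Proof.
apply/idP/eqP => [|->]; last by rewrite /hdot linear0 mul0mx mxE.
rewrite hdotE psumr_eq0 => [/allP a0|i _]; last exact: mul_scalar_conj_ge0.
apply/matrixP => i j; rewrite ord1 mxE; apply/eqP.
by rewrite -mul_scalar_conj_eq0; apply: a0; rewrite mem_index_enum.
Qed.

Lemma hdot_gt0 a : (0 < hdot a a) = (a != 0).
Proof. by rewrite lt0r hdot_eq0 hdot_ge0 andbT. Qed.

(** Membership in the group reads A A^* = 1.  Square matrices have two-sided
    inverses, so A^* A = 1, and the transpose of this is the identity that
    appears when A is moved across [hdot]. *)
Lemma in_group_trmxK (A : 'M[scalar_field R H]_d) :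
  A \in @in_group R H d -> A^T *m map_mx (@scalar_conj R H) A = 1%:M.
Proof.
case: H A => A /=; rewrite inE.
  by move/eqP/mulmx1C; rewrite (_ : map_mx _ A = A) //; apply/matrixP=> i j; rewrite mxE.
move/unitarymxP/mulmx1C/(congr1 trmx).
by rewrite trmx_mul trmx1 map_trmx trmxK.
Qed.

Lemma in_group_isometry (A : 'M[scalar_field R H]_d) a b :
  A \in @in_group R H d -> hdot (A *m a) (A *m b) = hdot a b.
Proof.
move=> /in_group_trmxK A1.
by rewrite /hdot trmx_mul map_mxM mulmxA -(mulmxA _ A^T) A1 mulmx1.
Qed.

End HermitianForm.

(** * Integration against the vertex measure *)

Section Integration.
Variables (R : realType) (V : finType) (e : rel V) (w : V -> V -> R) (mu : V -> R).
Hypotheses (hG : weighted_graph e w) (hmu : forall x, 0 < mu x).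
Variable H : structure_group.

(** The measure cancels the normalisation of the Laplacian; reversing the edges
    shows that the remaining double sum is its own opposite. *)
Lemma sum_laplacian (u : V -> scalar_field R H) :
  \sum_x of_real H (mu x) * laplacian e w mu u x = 0.
Proof.
have [symG _ wG] := hG.
transitivity (\sum_x \sum_(y | e x y) of_real H (w x y) * (u y - u x)).
  apply: eq_bigr => x _; rewrite /laplacian mulrA -rmorphM /= mulfV ?gt_eqF//.
  by rewrite rmorph1 mul1r.
set S := LHS; have SN : S = - S.
  rewrite {1}/S (exchange_big_dep xpredT) /= // -sumrN.
  apply: eq_bigr => x _; rewrite -sumrN.
  apply: eq_big => [y|y exy]; first exact: symG.
  by rewrite (wG _ _ exy).1 -mulrN opprB.
by move/eqP: SN; rewrite -addr_eq0 -mulr2n mulrn_eq0 => /eqP.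
Qed.

(** The form in which [sum_laplacian] is used: Gamma and Gamma_2 of an
    eigenfunction are a Laplacian plus a multiple of a simpler density, and a
    Laplacian may be discarded under the integral. *)
Lemma sum_mod_laplacian (c a : scalar_field R H) (u v g : V -> scalar_field R H) :
  (forall x, u x = c * laplacian e w mu v x + a * g x) ->
  \sum_x of_real H (mu x) * u x = a * \sum_x of_real H (mu x) * g x.
Proof.
move=> uE; transitivity (c * (\sum_x of_real H (mu x) * laplacian e w mu v x) +
                         a * \sum_x of_real H (mu x) * g x).
  by rewrite !mulr_sumr -big_split; apply: eq_bigr => x _ /=; rewrite uE; ring.
by rewrite sum_laplacian mulr0 add0r.
Qed.

End Integration.

(** * The curvature forms *)

Section Curvature.
Variables (R : realType) (V : finType) (e : rel V) (w : V -> V -> R) (mu : V -> R).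
Variables (H : structure_group) (d : nat) (sigma : V -> V -> 'M[scalar_field R H]_d).
Hypotheses (hG : weighted_graph e w) (hmu : forall x, 0 < mu x).
Implicit Types (f g : V -> 'cV[scalar_field R H]_d) (r : R).

Local Notation Lap := (laplacian e w mu).
Local Notation CLap := (connection_laplacian e w mu sigma).
Local Notation Gam := (Gamma e w mu sigma).
Local Notation Gam2 := (Gamma2 e w mu sigma).

Lemma laplacianZ (c : scalar_field R H) u x :
  Lap (fun z => c * u z) x = c * Lap u x.
Proof.
rewrite /laplacian [RHS]mulrCA; congr (_ * _); rewrite mulr_sumr.
by apply: eq_bigr => y _; ring.
Qed.

Lemma connection_laplacianZ (c : scalar_field R H) f x :
  CLap (fun z => c *: f z) x = c *: CLap f x.
Proof.
rewrite /connection_laplacian scalerA [c * _]mulrC -scalerA.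
congr (_ *: _); rewrite scaler_sumr; apply: eq_bigr => y _.
by rewrite -scalemxAr -scalerBr !scalerA mulrC.
Qed.

(** The factor is real because it will be the eigenvalue; hence [Gamma] is
    homogeneous in both arguments alike, without conjugation. *)
Lemma GammaZl r f g x :
  Gam (fun z => of_real H r *: f z) g x = of_real H r * Gam f g x.
Proof.
have Lr : Lap (fun z => hdot (of_real H r *: f z) (g z)) x =
          of_real H r * Lap (fun z => hdot (f z) (g z)) x.
  rewrite -laplacianZ; congr (laplacian _ _ _ _ _).
  by apply: funext => z; rewrite hdotZl.
by rewrite /Gamma connection_laplacianZ Lr !hdotZl; ring.
Qed.


Lemma GammaZr r f g x :
  Gam f (fun z => of_real H r *: g z) x = of_real H r * Gam f g x.
Proof.
have Lr : Lap (fun z => hdot (f z) (of_real H r *: g z)) x =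
          of_real H r * Lap (fun z => hdot (f z) (g z)) x.
  rewrite -laplacianZ; congr (laplacian _ _ _ _ _).
  by apply: funext => z; rewrite hdotZr.
by rewrite /Gamma connection_laplacianZ Lr !hdotZr; ring.
Qed.

(** Write a = f(x) and b = sigma_xy f(y), so that |b| = |f(y)|.  The
    contribution of y to 2 Gamma(f,f)(x) is w_xy / mu(x) times
    |b|^2 - |a|^2 - <a, b - a> - <b - a, a> = |b - a|^2. *)
Lemma Gamma_ge0 f x :
  signature e sigma -> 0 <= Gam f f x.
Proof.
move=> hsigma.
suff -> : Gam f f x = 2^-1 * (of_real H (mu x)^-1 *
    \sum_(y | e x y) of_real H (w x y) *
      hdot (sigma x y *m f y - f x) (sigma x y *m f y - f x)).
  apply: mulr_ge0; first by rewrite invr_ge0 ler0n.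
  apply: mulr_ge0; first by rewrite of_real_ge0 invr_ge0 ltW.
  apply: sumr_ge0 => y exy; have [_ _ wG] := hG.
  by rewrite mulr_ge0 ?hdot_ge0 // of_real_ge0 ltW // (wG _ _ exy).2.
rewrite /Gamma /connection_laplacian hdotZl hdotZr /laplacian -!mulrBr.
rewrite hdot_suml hdot_sumr -!sumrB; congr (_ * (_ * _)).
apply: eq_bigr => y exy; rewrite hdotZl hdotZr !hdotBl !hdotBr.
by rewrite (in_group_isometry _ _ (hsigma _ _ exy).1); ring.
Qed.

(** * Eigenfunctions *)

Section Eigenfunction.
Variables (lambda : R) (f : V -> 'cV[scalar_field R H]_d).
Hypothesis hf : forall x, CLap f x = - (of_real H lambda *: f x).

Let CLapf x : CLap f x = of_real H (- lambda) *: f x.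
Proof. by rewrite hf rmorphN scaleNr. Qed.

Lemma sum_Gamma_eigenfunction :
  \sum_x of_real H (mu x) * Gam f f x =
  of_real H lambda * \sum_x of_real H (mu x) * hdot (f x) (f x).
Proof.
apply: (sum_mod_laplacian hG hmu (H := H) (c := 2^-1) (v := fun z => hdot (f z) (f z))) => x.
by rewrite /Gamma CLapf hdotZl hdotZr rmorphN; field.
Qed.

Lemma sum_Gamma2_eigenfunction :
  \sum_x of_real H (mu x) * Gam2 f f x =
  of_real H lambda * \sum_x of_real H (mu x) * Gam f f x.
Proof.
apply: (sum_mod_laplacian hG hmu (H := H) (c := 2^-1) (v := Gam f f)) => x.
by rewrite /Gamma2 (funext CLapf) GammaZl GammaZr rmorphN; field.
Qed.

End Eigenfunction.
End Curvature.

Theorem theorem6p1 (R : realType) (V : finType) (e : rel V)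
    (w : V -> V -> R) (mu : V -> R)
    (H : structure_group) (d : nat) (sigma : V -> V -> 'M[scalar_field R H]_d)
    (K : R) (n : \bar R)
    (hG : weighted_graph e w)
    (hmu : forall x, 0 < mu x)
    (hsigma : signature e sigma)
    (hn : (0 < n)%E)
    (hCD : CD e w mu sigma K n)
    (lambda : R)
    (hlambda : eigenvalue_of_connection_laplacian e w mu sigma lambda)
    (hlambda0 : lambda != 0) :
  K <= dim_ratio n * lambda.
Proof.
case: hlambda => f [[x0 fx0] hf].
have mu_ge0 x : 0 <= of_real H (mu x) by rewrite of_real_ge0 ltW.
set N := \sum_x of_real H (mu x) * hdot (f x) (f x).
have N_gt0 : 0 < N.
  rewrite /N (bigD1 x0) //= ltr_pwDl ?mulr_gt0 ?of_real_gt0 ?hdot_gt0 //.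
  by rewrite sumr_ge0 // => x _; rewrite mulr_ge0 ?hdot_ge0.
have sumG := sum_Gamma_eigenfunction hG hmu hf; rewrite -/N in sumG.
have lambda_gt0 : 0 < lambda.
  rewrite lt0r hlambda0 -(of_real_ge0 H) -(pmulr_lge0 _ N_gt0) -sumG.
  by rewrite sumr_ge0 // => x _; rewrite mulr_ge0 ?Gamma_ge0.
have ratioE : dim_ratio n = 1 - inv_dim n.
  case: n hn {hCD} => [r| |] //= r0; last by rewrite subr0.
  by rewrite mulrBl mulfV ?mul1r // gt_eqF.
have sumCD : of_real H (inv_dim n * lambda ^+ 2 + K * lambda) * N <=
             of_real H (lambda ^+ 2) * N.
  (* The factors lambda are absorbed into integrals of Gamma and Gamma_2, which
     turns both sides into sums over the vertices compared termwise by CD. *)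
  rewrite expr2 [in leRHS]rmorphM -mulrA -sumG -(sum_Gamma2_eigenfunction hG hmu hf).
  rewrite rmorphD mulrDl [X in _ + X * _]rmorphM /= -(mulrA (of_real H K)) -sumG.
  rewrite /N !mulr_sumr -big_split /=; apply: ler_sum => x _.
  rewrite mulrCA [in X in _ + X]mulrCA -mulrDr ler_wpM2l //.
  apply: le_trans (hCD f x); rewrite le_eqVlt; apply/orP; left; apply/eqP.
  rewrite hf -scaleNr -rmorphN hdotZl hdotZr !rmorphM rmorphN.
  by ring.
rewrite ler_pM2r // ler_of_real in sumCD.
(* Multiplied by lambda > 0, the claim is the inequality just obtained. *)
rewrite ratioE -(ler_pM2r lambda_gt0) mulrBl mul1r mulrBl -mulrA -expr2.
by rewrite lerBrDl.
Qed.
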